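(* Let $\mathcal F$ be a good class. Let $O\subseteq\mathbb R^N$ be $\mathcal F$-approximable, $V\subseteq\mathbb R^N$ open, and $F:O\to V$ a bijection which is in $\mathcal F$. Assume the inverse $G:V\to O$ satisfies: (i) there is an $\mathcal F$-function $d':\mathbb N\to\mathbb N$ such that $|G(y)-G(y')|<1/e$ for all integers $e\ge1$ and all $y,y'\in V_e$ with $|y-y'|<1/d'(e)$; (ii) $G$ is $\mathcal F$-compact. Then $G$ is in $\mathcal F$.
   Context: A class $\mathcal F$ of functions $\mathbb N^n\to\mathbb N$ ($n$ varying) is good if it contains all constant functions, projections, the successor function and $x\dot- y=\max\{0,x-y\}$, and is closed under composition and bounded summation $f(\bar x,y)=\sum_{i=0}^y g(\bar x,i)$. Functions and relations involving $\mathbb Q$ are coded by natural numbers ($z\in\mathbb Z$ by $(\max(z,0),-\min(0,z))$, $r\in\mathbb Q$ by $(z,n)$ with $r=z/n$, $n>0$, $\gcd(z,n)=1$) and are in $\mathcal F$ if the coded function (resp. characteristic function) is componentwise in $\mathcal F$. On $\mathbb R^N$ use the maximum norm. For open $O\subseteq\mathbb R^N$ and integer $e\ge1$ let $O_e=\{x\in O:|x|\le e,\ \mathrm{dist}(x,\mathbb R^N\setminus O)\ge1/e\}$. A function $F:O\to\mathbb R^M$ is in $\mathcal F$ if there are $\mathcal F$-functions $d:\mathbb N\to\mathbb N$ and $f:\mathbb Q^N\times\mathbb N\to\mathbb Q^M$ such that for all integers $e\ge1$, all $a\in\mathbb Q^N$ and all $x\in O_e$: $|x-a|<1/d(e)$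 implies $|F(x)-f(a,e)|<1/e$. A function $G:V\to O$ between open sets is $\mathcal F$-compact if there is an $\mathcal F$-function $\gamma:\mathbb N\to\mathbb N$ with $G(V_e)\subseteq O_{\gamma(e)}$ for all $e\ge1$. An open set $O\subseteq\mathbb R^N$ is $\mathcal F$-approximable if there are subsets $A_1,A_2,\ldots\subseteq\mathbb Q^N$ such that $\{(e,a):a\in A_e\}$ is an $\mathcal F$-subset of $\mathbb N_{>0}\times\mathbb Q^N$, and an $\mathcal F$-function $\alpha:\mathbb N\to\mathbb N$, with $O_e\cap\mathbb Q^N\subseteq A_e\subseteq O_{\alpha(e)}$ for all $e\ge1$. *)

(* Defs.v *)
From HB Require Import structures.
From mathcomp Require Import all_boot all_order all_algebra.
From mathcomp Require Import all_classical all_reals all_analysis.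

Set Implicit Arguments.
Unset Strict Implicit.
Unset Printing Implicit Defensive.

Import Order.TTheory GRing.Theory Num.Theory.
Import numFieldNormedType.Exports.

Local Open Scope classical_set_scope.
Local Open Scope ring_scope.

(* N^n is 'rV[nat]_n; arity 0 is allowed. *)
Definition fun_class := forall n : nat, ('rV[nat]_n -> nat) -> Prop.

Record good_class (C : fun_class) : Prop := GoodClass {
  good_const : forall n c : nat, C n (fun=> c);
  good_proj : forall (n : nat) (i : 'I_n), C n (fun x => x 0 i);
  good_succ : C 1%N (fun x => (x 0 0).+1);
  good_monus : C 2%N (fun x => (x 0%R 0%R - x 0%R 1%R)%N);
  good_comp : forall (m n : nat) (f : 'rV[nat]_m -> nat)
      (g : 'I_m -> 'rV[nat]_n -> nat),
    C m f -> (forall i, C n (g i)) -> C n (fun x => f (\row_i g i x));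
  good_sum : forall (n : nat) (g : 'rV[nat]_(n + 1) -> nat),
    C (n + 1)%N g ->
    C (n + 1)%N (fun z : 'rV[nat]_(n + 1) =>
      (\sum_(0 <= i < (rsubmx z 0%R 0%R).+1)
         g (row_mx (lsubmx z) (const_mx i)))%N)
}.

Definition in_class1 (C : fun_class) (d : nat -> nat) : Prop :=
  C 1%N (fun x => d (x 0 0)).

Definition code_nat (e : nat) : 'rV[nat]_1 := const_mx e.

Definition code_int (z : int) : 'rV[nat]_2 :=
  row_mx (const_mx (absz (Num.max z 0)) : 'rV_1)
         (const_mx (absz (- Num.min 0 z)) : 'rV_1).

(* numq r / denq r is the reduced fraction of r, with denq r > 0. *)
Definition code_rat (r : rat) : 'rV[nat]_(2 + 1) :=
  row_mx (code_int (numq r)) (const_mx (absz (denq r))).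

Definition code_ratv (N : nat) (a : 'rV[rat]_N) : 'rV[nat]_(N * (2 + 1)) :=
  mxvec (\matrix_i code_rat (a 0 i)).

(* The coded function is only defined on the codes of elements of X, hence it
   is required to have an extension to N^m which belongs to the class (for a
   good class this is the same as extending it by 0, the set of codes of
   rational tuples being itself in the class). *)
Definition in_class_fun (C : fun_class) (X Y : Type) (m n : nat)
    (cX : X -> 'rV[nat]_m) (cY : Y -> 'rV[nat]_n) (f : X -> Y) : Prop :=
  forall k : 'I_n, exists phi : 'rV[nat]_m -> nat,
    C m phi /\ forall x, phi (cX x) = cY (f x) 0 k.

(* S as a subset of D *)
Definition in_class_set (C : fun_class) (X : Type) (m : nat)
    (cX : X -> 'rV[nat]_m) (D S : set X) : Prop :=
  exists chi : 'rV[nat]_m -> nat,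
    C m chi /\ forall x, D x -> chi (cX x) = nat_of_bool `[< S x >].

Section reals.
Variable R : realType.

Definition ratv (N : nat) (a : 'rV[rat]_N) : 'rV[R]_N := map_mx ratr a.

(* The norm on 'rV[R]_N is the maximum norm. The distance is extended-real
   valued, and is +oo when the complement of O is empty. *)
Definition inner (N : nat) (O : set 'rV[R]_N) (e : nat) : set 'rV[R]_N :=
  [set x | [/\ O x, `|x| <= e%:R & ((e%:R^-1)%:E <= edist_inf (~` O) x)%E]].

(* Functions on O are total functions whose values off O are irrelevant.
   Positivity of d e (and of the indices gam e, alpha e below) gives meaning to
   1 / d e, as 0^-1 = 0 here. *)
Definition in_class_real (C : fun_class) (N M : nat) (O : set 'rV[R]_N)
    (F : 'rV[R]_N -> 'rV[R]_M) : Prop :=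
  exists (d : nat -> nat) (f : 'rV[rat]_N * nat -> 'rV[rat]_M),
    [/\ in_class1 C d,
        in_class_fun C (fun ae => row_mx (code_ratv ae.1) (code_nat ae.2))
          (@code_ratv M) f,
        forall e : nat, (0 < e)%N -> (0 < d e)%N &
        forall (e : nat) (a : 'rV[rat]_N) (x : 'rV[R]_N),
          (0 < e)%N -> inner O e x ->
          `|x - ratv a| < (d e)%:R^-1 ->
          `|F x - ratv (f (a, e))| < e%:R^-1].

Definition class_compact (C : fun_class) (N M : nat) (V : set 'rV[R]_N)
    (O : set 'rV[R]_M) (G : 'rV[R]_N -> 'rV[R]_M) : Prop :=
  exists gam : nat -> nat,
    in_class1 C gam /\
    forall e : nat, (0 < e)%N ->
      (0 < gam e)%N /\ G @` inner V e `<=` inner O (gam e).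

Definition class_approximable (C : fun_class) (N : nat) (O : set 'rV[R]_N)
    : Prop :=
  open O /\
  exists (A : nat -> set 'rV[rat]_N) (alpha : nat -> nat),
    [/\ in_class_set C (fun ea => row_mx (code_nat ea.1) (code_ratv ea.2))
          [set ea | (0 < ea.1)%N] [set ea | A ea.1 ea.2],
        in_class1 C alpha &
        forall e : nat, (0 < e)%N ->
          [/\ (0 < alpha e)%N, @ratv N @^-1` inner O e `<=` A e &
              @ratv N @` A e `<=` inner O (alpha e)]].

End reals.

(* Main.v *)
Require Import Defs.
From HB Require Import structures.
From mathcomp Require Import all_boot all_order all_algebra.
From mathcomp Require Import all_classical all_reals all_analysis.
From mathcomp Require Import zify ring lra.
Set Implicit Arguments.
Unset Strict Implicit.
Unset Printing Implicit Defensive.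

Import Order.TTheory GRing.Theory Num.Theory.
Import numFieldNormedType.Exports.
Local Open Scope classical_set_scope.
Local Open Scope ring_scope.

(** To approximate [G y] from a rational vector [b] near [y], search a finite
    grid of rational points [a] in the approximating set [A_(2 gam(e))] for the
    first one at which the approximation [f(a, D(e))] of [F a] is close to [b].
    As [G] is class-compact, [G y] lies in [O_(gam(e))], so the grid points next to
    [G y] qualify and the search succeeds. Whatever [a] it returns satisfies
    [F a] close to [y], hence [F a] in [V_(2e)], and the modulus of continuity
    of [G] makes [a = G (F a)] close to [G y].  The search is in the class
    because bounded summation yields products, division, greatest common
    divisors (needed to reduce fractions) and bounded minimisation, and because
    the grid points are indexed by a single number read in a fixed base. *)

(** * Membership in a class for functions of coded arguments *)

(** Only the values on codes count, so arguments can stay abstract elements of [X] and closure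
    properties can be applied pointwise. *)
Definition class_nat (C : fun_class) (X : Type) (m : nat)
    (cX : X -> 'rV[nat]_m) (f : X -> nat) : Prop :=
  exists phi : 'rV[nat]_m -> nat, C m phi /\ forall x, phi (cX x) = f x.

Definition class_row (C : fun_class) (X : Type) (m p : nat)
    (cX : X -> 'rV[nat]_m) (v : X -> 'rV[nat]_p) : Prop :=
  forall k, class_nat C cX (fun x => v x 0 k).

(** The extra number is the last coordinate, the one that [good_sum] sums over. *)
Definition code_ext (X : Type) (m : nat) (cX : X -> 'rV[nat]_m) :
    X * nat -> 'rV[nat]_(m + 1) :=
  fun xi => row_mx (cX xi.1) (code_nat xi.2).

(** * Minimisation and greatest common divisors by bounded operations *)

(** Summand [i] is 1 as long as no [j <= i] satisfies [P] and 0 afterwards, so the sum counts the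
    indices before the first witness. *)
Lemma find_iota_sum (P : pred nat) n :
  find P (iota 0 n) =
  (\sum_(0 <= i < n) ((\sum_(0 <= j < i.+1) P j) == 0))%N.
Proof.
elim: n => [|n IH]; first by rewrite big_nil.
rewrite -addn1 iotaD add0n find_cat size_iota addn1 big_nat_recr //= -IH.
have sumE m : (\sum_(0 <= j < m) P j == 0)%N = ~~ has P (iota 0 m).
  rewrite sum_nat_seq_eq0 -all_predC /index_iota subn0.
  by apply: eq_all => j /=; case: (P j).
rewrite sumE -(addn1 n) iotaD has_cat negb_or /= orbF.
by case: ifPn => [_|/hasNfind ->]; rewrite /= ?addn0 // size_iota; case: (P n).
Qed.

(** The candidates [k - t] are tried downwards from [k], so the first common divisor met is the
    greatest. As [k] is positive, the gcd is at most [k] and hence among them. *)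
Lemma gcdn_find m k : (0 < k)%N ->
  gcdn m k =
  (k - find (fun t => ((k - t) %| m) && ((k - t) %| k)) (iota 0 k.+1))%N.
Proof.
move=> k0; set p := (X in find X _).
have g0 : (0 < gcdn m k)%N by rewrite gcdn_gt0 k0 orbT.
have gk : (gcdn m k <= k)%N by rewrite dvdn_leq // dvdn_gcdr.
have pg : p (k - gcdn m k)%N by rewrite /p subKn // dvdn_gcdl dvdn_gcdr.
have kg : (k - gcdn m k < k.+1)%N by lia.
have hp : has p (iota 0 k.+1).
  by apply/hasP; exists (k - gcdn m k)%N => //; rewrite mem_iota.
have lek : (find p (iota 0 k.+1) < k.+1)%N.
  by move: hp; rewrite has_find size_iota.
have := nth_find 0%N hp; rewrite nth_iota // add0n.
have := @before_find _ 0%N p (iota 0 k.+1) (k - gcdn m k)%N.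
rewrite nth_iota // add0n pg.
case: ltnP => [_ /(_ isT)//|le_find _ /andP[d1 d2]].
have := dvdn_leq g0 (_ : (k - find p (iota 0 k.+1) %| gcdn m k)%N).
by rewrite dvdn_gcd d1 d2 => /(_ isT); lia.
Qed.

(** * Closure under composition, dummy variables and bounded sums *)

Section GoodClass.
Context (C : fun_class).
Arguments C : clear implicits.
Context (hC : good_class C).
Context (X : Type) (m : nat).
Implicit Types (cX : X -> 'rV[nat]_m) (f g : X -> nat) (P Q : pred X).

Lemma class_nat_comp cX (p : nat) (phi : 'rV[nat]_p -> nat)
    (v : X -> 'rV[nat]_p) :
  C p phi -> class_row C cX v -> class_nat C cX (fun x => phi (v x)).
Proof.
move=> Cphi /choice[psi psiP].
exists (fun z => phi (\row_k psi k z)); split.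
  by apply: (good_comp hC) => // k; have [] := psiP k.
by move=> x; congr phi; apply/rowP => k; rewrite mxE; have [_ ->] := psiP k.
Qed.

Lemma eq_class_nat cX f g : f =1 g -> class_nat C cX f -> class_nat C cX g.
Proof.
by move=> fg [phi [? phif]]; exists phi; split => // x; rewrite phif fg.
Qed.

Lemma class_nat_proj cX k : class_nat C cX (fun x => cX x 0 k).
Proof. by exists (fun z => z 0 k); split => //; apply: (good_proj hC). Qed.

Lemma class_nat_const cX c : class_nat C cX (fun=> c).
Proof. by exists (fun=> c); split => //; apply: (good_const hC). Qed.

Lemma class_row_nat cX f : class_nat C cX f ->
  class_row C cX (fun x => code_nat (f x)).
Proof. by move=> Cf k; apply: eq_class_nat Cf => x; rewrite mxE. Qed.

Lemma class_row_mx cX p q (v : X -> 'rV[nat]_p) (w : X -> 'rV[nat]_q) :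
  class_row C cX v -> class_row C cX w ->
  class_row C cX (fun x => row_mx (v x) (w x)).
Proof.
move=> Cv Cw k; rewrite -(splitK k); case: (fintype.split k) => j /=.
  by apply: eq_class_nat (Cv j) => x; rewrite row_mxEl.
by apply: eq_class_nat (Cw j) => x; rewrite row_mxEr.
Qed.

Lemma class_nat_comp1 cX (d : nat -> nat) f :
  in_class1 C d -> class_nat C cX f -> class_nat C cX (fun x => d (f x)).
Proof.
move=> Cd Cf; apply: eq_class_nat (class_nat_comp Cd (class_row_nat Cf)) => x.
by rewrite mxE.
Qed.

Lemma class_natS cX f : class_nat C cX f -> class_nat C cX (fun x => (f x).+1).
Proof. exact/class_nat_comp1/(good_succ hC). Qed.

Lemma class_natB cX f g : class_nat C cX f -> class_nat C cX g ->
  class_nat C cX (fun x => f x - g x)%N.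
Proof.
move=> Cf Cg.
have Cv : class_row C cX (fun x => \row_(k < 2) if k == 0 then f x else g x).
  move=> k; case k0 : (k == 0);
    [apply: eq_class_nat Cf|apply: eq_class_nat Cg] => x; by rewrite mxE k0.
by apply: eq_class_nat (class_nat_comp (good_monus hC) Cv) => x; rewrite !mxE.
Qed.

Lemma class_nat_weak cX f : class_nat C cX f ->
  class_nat C (code_ext cX) (fun xi => f xi.1).
Proof.
move=> [phi [Cphi phif]].
exists (fun z : 'rV_(m + 1) => phi (lsubmx z)); split; last first.
  by move=> xi; rewrite row_mxKl phif.
(* The left block is written as a row of projections so that [good_comp] applies. *)
rewrite (_ : (fun z => _) =
    fun z : 'rV_(m + 1) => phi (\row_i z 0 (lshift 1 i))).
  by apply: (good_comp hC) => // i; apply: (good_proj hC).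
by apply/funext => z; congr phi; apply/rowP => i; rewrite !mxE.
Qed.

Lemma class_nat_var cX : class_nat C (code_ext cX) snd.
Proof.
exists (fun z : 'rV_(m + 1) => z 0 (rshift m 0)); split.
  exact: (good_proj hC).
by move=> xi; rewrite row_mxEr mxE.
Qed.

Lemma class_nat_sum cX (g : X -> nat -> nat) f :
  class_nat C (code_ext cX) (fun xi => g xi.1 xi.2) -> class_nat C cX f ->
  class_nat C cX (fun x => \sum_(0 <= i < (f x).+1) g x i)%N.
Proof.
move=> [phi [Cphi phig]] /class_row_nat Cf.
apply: eq_class_nat
  (class_nat_comp (good_sum hC Cphi)
    (class_row_mx (class_nat_proj cX) Cf)) => x.
rewrite row_mxKr row_mxKl mxE; apply: eq_bigr => i _.
by rewrite -(phig (x, i)).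
Qed.

End GoodClass.

(** * Arithmetic and comparisons *)

Section Arithmetic.
Context (C : fun_class).
Arguments C : clear implicits.
Context (hC : good_class C).
Context (X : Type) (m : nat) (cX : X -> 'rV[nat]_m).
Implicit Types (f g : X -> nat) (P Q : pred X).

(** A bounded sum includes its upper index: summing the constant [f x] up to [g x] gives
    [f x * (g x + 1)], from which one copy of [f x] is subtracted. *)
Lemma class_natM f g : class_nat C cX f -> class_nat C cX g ->
  class_nat C cX (fun x => f x * g x)%N.
Proof.
move=> Cf Cg.
have Csum := class_nat_sum (g := fun x _ => f x) hC (class_nat_weak hC Cf) Cg.
apply: eq_class_nat (class_natB hC Csum Cf) => x.
by rewrite /= sum_nat_const_nat subn0 mulSn addKn mulnC.
Qed.

(* [(x + 1) * (y + 1) = x * y + x + y + 1] expresses addition by the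
   operations already available. *)
Lemma class_natD f g : class_nat C cX f -> class_nat C cX g ->
  class_nat C cX (fun x => f x + g x)%N.
Proof.
move=> Cf Cg.
have CM := class_natM (class_natS hC Cf) (class_natS hC Cg).
have CM1 := class_natB hC CM (class_nat_const hC cX 1).
have := class_natB hC CM1 (class_natM Cf Cg).
by apply: eq_class_nat => x; lia.
Qed.

Lemma class_natX f k : class_nat C cX f -> class_nat C cX (fun x => f x ^ k)%N.
Proof.
move=> Cf; elim: k => [|k IH]; first exact: class_nat_const.
by apply: eq_class_nat (class_natM Cf IH) => x; rewrite expnS.
Qed.

Lemma class_nat_and P Q : class_nat C cX P -> class_nat C cX Q ->
  class_nat C cX (fun x => P x && Q x).
Proof.
by move=> CP CQ; apply: eq_class_nat (class_natM CP CQ) => x; rewrite mulnb.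
Qed.

Lemma class_nat_all (I : Type) (s : seq I) (P : I -> pred X) :
  (forall i, class_nat C cX (P i)) ->
  class_nat C cX (fun x => all (fun i => P i x) s).
Proof.
move=> CP; elim: s => [|i s IH]; first exact: class_nat_const.
exact: class_nat_and.
Qed.

(** The truth value is [1 - (f x - g x)] in truncated subtraction. *)
Lemma class_nat_leq f g : class_nat C cX f -> class_nat C cX g ->
  class_nat C cX (fun x => f x <= g x)%N.
Proof.
move=> Cf Cg.
have := class_natB hC (class_nat_const hC cX 1) (class_natB hC Cf Cg).
by apply: eq_class_nat => x; case: leqP; lia.
Qed.

Lemma class_nat_eq f g : class_nat C cX f -> class_nat C cX g ->
  class_nat C cX (fun x => f x == g x).
Proof.
move=> Cf Cg; have := class_nat_and (class_nat_leq Cf Cg) (class_nat_leq Cg Cf).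
by apply: eq_class_nat => x; rewrite eqn_leq.
Qed.

End Arithmetic.

(** * Bounded search and division *)

Section Search.
Context (C : fun_class).
Arguments C : clear implicits.
Context (hC : good_class C).
Context (X : Type) (m : nat) (cX : X -> 'rV[nat]_m).
Implicit Types (f g : X -> nat).

Lemma class_nat_find (P : X -> pred nat) f :
  class_nat C (code_ext cX) (fun xi => P xi.1 xi.2) -> class_nat C cX f ->
  class_nat C cX (fun x => find (P x) (iota 0 (f x).+1)).
Proof.
move=> CP Cf.
(* The inner sum of [find_iota_sum] runs over [j] with [i] as a parameter, so [P] is recoded with
   two extra variables, the first of which it ignores. *)
have CP2 : class_nat C (code_ext (code_ext cX)) (fun xij => P xij.1.1 xij.2).
  case: CP => phi [Cphi phiP].
  have Cv : class_row C (code_ext (code_ext cX))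
      (fun xij => row_mx (cX xij.1.1) (code_nat xij.2)).
    apply: class_row_mx => //; last exact/class_row_nat/class_nat_var.
    move=> k; apply: (class_nat_weak hC (f := fun xi => cX xi.1 0 k)).
    apply: (class_nat_weak hC (f := fun x => cX x 0 k)).
    exact: class_nat_proj.
  apply: eq_class_nat (class_nat_comp hC Cphi Cv) => -[[x i] j].
  exact: (phiP (x, j)).
have Csum :=
  class_nat_sum (g := fun xi j => P xi.1 j) hC CP2 (class_nat_var hC cX).
have C0 := class_nat_eq hC Csum (class_nat_const hC _ 0).
have := class_nat_sum
  (g := fun x i => ((\sum_(0 <= j < i.+1) P x j)%N == 0%N)) hC C0 Cf.
by apply: eq_class_nat => x; rewrite find_iota_sum.
Qed.

(** The quotient counts the [i] with [(i + 1) * g x <= f x]. The test [0 < g x] makes the count 0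
    for a zero divisor, in accordance with [divn0]. *)
Lemma class_nat_div f g : class_nat C cX f -> class_nat C cX g ->
  class_nat C cX (fun x => f x %/ g x)%N.
Proof.
move=> Cf Cg.
have Cfw := class_nat_weak hC Cf; have Cgw := class_nat_weak hC Cg.
have CM := class_natM hC (class_natS hC (class_nat_var hC cX)) Cgw.
have Cg0 := class_nat_leq hC (class_nat_const hC _ 1) Cgw.
have CQ := class_nat_and hC Cg0 (class_nat_leq hC CM Cfw).
have := class_nat_sum
  (g := fun x i => (0 < g x)%N && (i.+1 * g x <= f x)%N) hC CQ Cf.
apply: eq_class_nat => x.
have [->|g0] := posnP (g x); first by rewrite divn0 big1.
under eq_bigr => i _ do rewrite /= -leq_divRL //.
have le_q : (f x %/ g x <= (f x).+1)%N by rewrite leqW // leq_div.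
rewrite (big_cat_nat (leq0n _) le_q) //= big_nat.
under eq_bigr => i /andP[_ ->] do [].
rewrite -big_nat sum_nat_const_nat subn0 muln1 big_nat.
rewrite big1 ?addn0 // => i /andP[qi _].
by rewrite ltnNge qi.
Qed.

Lemma class_nat_mod f g : class_nat C cX f -> class_nat C cX g ->
  class_nat C cX (fun x => f x %% g x)%N.
Proof.
move=> Cf Cg.
have CM := class_natM hC (class_nat_div Cf Cg) Cg.
apply: eq_class_nat (class_natB hC Cf CM) => x.
by rewrite {1}(divn_eq (f x) (g x)) addKn.
Qed.

Lemma class_nat_dvd f g : class_nat C cX f -> class_nat C cX g ->
  class_nat C cX (fun x => f x %| g x)%N.
Proof.
move=> Cf Cg.
exact: class_nat_eq (class_nat_mod Cg Cf) (class_nat_const hC cX 0).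
Qed.

End Search.

Lemma class_nat_gcd (C : fun_class) (hC : good_class C) (X : Type) (m : nat)
    (cX : X -> 'rV[nat]_m) (f g : X -> nat) :
  (forall x, 0 < g x)%N -> class_nat C cX f -> class_nat C cX g ->
  class_nat C cX (fun x => gcdn (f x) (g x)).
Proof.
move=> g0 Cf Cg.
have Cgw := class_nat_weak hC Cg.
have CB := class_natB hC Cgw (class_nat_var hC cX).
have CP := class_nat_and hC (class_nat_dvd hC CB (class_nat_weak hC Cf))
  (class_nat_dvd hC CB Cgw).
have := class_natB hC Cg (class_nat_find
  (P := fun x t => ((g x - t) %| f x)%N && ((g x - t) %| g x)%N) hC CP Cg).
by apply: eq_class_nat => x; rewrite gcdn_find.
Qed.

(** * Codes of rational numbers *)

(** [rat_pos], [rat_neg] and [rat_den] are the three numbers stored by [code_rat]. *)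
Definition rat_pos (r : rat) : nat := absz (Num.max (numq r) 0).
Definition rat_neg (r : rat) : nat := absz (- Num.min 0 (numq r)).
Definition rat_den (r : rat) : nat := absz (denq r).

Lemma rat_den_gt0 r : (0 < rat_den r)%N.
Proof. by rewrite /rat_den absz_gt0 denq_neq0. Qed.

Lemma rat_posB_neg r : (rat_pos r)%:R - (rat_neg r)%:R = (numq r)%:~R :> rat.
Proof.
rewrite /rat_pos /rat_neg !pmulrn -!intrB; congr (_%:~R).
by case: (leP 0 (numq r)); lia.
Qed.

Lemma ratE r : r = ((rat_pos r)%:R - (rat_neg r)%:R) / (rat_den r)%:R.
Proof.
rewrite rat_posB_neg -[LHS]divq_num_den; congr (_ / _).
by rewrite /rat_den pmulrn gtz0_abs // denq_gt0.
Qed.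

Lemma natrB_monus (a b : nat) :
  a%:R - b%:R = (a - b)%N%:R - (b - a)%N%:R :> rat.
Proof.
have [ab|/ltnW ab] := leqP a b; rewrite (natrB _ ab).
  by rewrite (eqP (ab : a - b == 0)%N) sub0r opprB.
by rewrite (eqP (ab : b - a == 0)%N) subr0.
Qed.

Lemma dist_natr_monus (a b : nat) :
  `|a%:R - b%:R| = ((a - b) + (b - a))%:R :> rat.
Proof.
have [ab|/ltnW ab] := leqP a b.
  rewrite distrC ger0_norm ?subr_ge0 ?ler_nat // -natrB //.
  by rewrite (eqP (ab : a - b == 0)%N).
rewrite ger0_norm ?subr_ge0 ?ler_nat // -natrB //.
by rewrite (eqP (ab : b - a == 0)%N) addn0.
Qed.

(** Over the product of the denominators, [r - s] has as numerator the difference of [a] and [b];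
    negative terms are moved across to make both natural. The comparison thus becomes a test on
    natural numbers. *)
Lemma rat_dist_lt (r s : rat) (q : nat)
    (a := (rat_pos r * rat_den s + rat_neg s * rat_den r)%N)
    (b := (rat_neg r * rat_den s + rat_pos s * rat_den r)%N) :
  (`|r - s| * q%:R < 2) =
  (((a - b) + (b - a)) * q < 2 * (rat_den r * rat_den s))%N.
Proof.
have r0 : 0 < (rat_den r)%:R :> rat by rewrite ltr0n rat_den_gt0.
have s0 : 0 < (rat_den s)%:R :> rat by rewrite ltr0n rat_den_gt0.
have -> : r - s = (a%:R - b%:R) / ((rat_den r)%:R * (rat_den s)%:R).
  rewrite {1}(ratE r) {1}(ratE s) /a /b !natrD !natrM; field.
  by rewrite !lt0r_neq0.
rewrite normrM normfV (gtr0_norm (mulr_gt0 r0 s0)) mulrAC.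
rewrite ltr_pdivrMr ?mulr_gt0 //.
by rewrite dist_natr_monus -!natrM ltr_nat.
Qed.

(* One of [i - K] and [K - i] is [0], so their sum is the absolute value of the
   numerator. *)
Lemma rat_frac (i K k : nat) (r : rat := (i%:R - K%:R) / k%:R)
    (g := gcdn ((i - K) + (K - i)) k) : (0 < k)%N ->
  [/\ rat_pos r = ((i - K) %/ g)%N, rat_neg r = ((K - i) %/ g)%N &
      rat_den r = (k %/ g)%N].
Proof.
move=> k0.
have g0 : (0 < g)%N by rewrite gcdn_gt0 k0 orbT.
pose z : int := ((i - K) %/ g)%N%:Z - ((K - i) %/ g)%N%:Z.
have gdvd : (g %| i - K)%N && (g %| K - i)%N.
  have := dvdn_gcdl ((i - K) + (K - i)) k; rewrite -/g.
  have [/eqP iK|/ltnW/eqP iK] := leqP i K; rewrite iK.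
    by rewrite add0n dvdn0.
  by rewrite addn0 dvdn0 => ->.
case/andP: gdvd => gd1 gd2.
have gd3 : (g %| k)%N by exact: dvdn_gcdr.
have kg0 : (0 < k %/ g)%N by rewrite divn_gt0 // dvdn_leq.
have rE : r = z%:~R / (k %/ g)%N%:Z%:~R.
  have gN0 : g%:R != 0 :> rat by rewrite pnatr_eq0 -lt0n.
  have kN0 : (k %/ g)%N%:R != 0 :> rat by rewrite pnatr_eq0 -lt0n.
  have -> : r = (i - K)%N%:R / k%:R - (K - i)%N%:R / k%:R.
    by rewrite -mulrBl -natrB_monus.
  rewrite -{1}(divnK gd1) -{1}(divnK gd2) -{1 2}(divnK gd3) !natrM /z.
  rewrite intrB -!pmulrn; field.
  by rewrite gN0 kN0.
have absz_z : absz z = (((i - K) + (K - i)) %/ g)%N.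
  rewrite divnDl // /z.
  have [/eqP iK|/ltnW/eqP iK] := leqP i K;
    by rewrite iK div0n ?add0n ?addn0 ?sub0r ?subr0 ?abszN absz_nat.
(* Cancelling the gcd [g] leaves a reduced fraction, from which [numq] and [denq] can be read
   off. *)
have cop : coprime (absz z) (absz (k %/ g)%N%:Z).
  rewrite absz_z absz_nat /coprime -(eqn_pmul2r g0) mul1n muln_gcdl !divnK //.
  exact: dvdn_gcdl.
have zpos : (i - K == 0)%N || (K - i == 0)%N by lia.
have numE : numq r = z.
  by rewrite rE coprimeq_num // gtr0_sg ?mul1r // ltz_nat.
have denE : denq r = (k %/ g)%N.
  by rewrite rE coprimeq_den // eqz_nat gtn_eqF.
rewrite /rat_pos /rat_neg /rat_den numE denE /z.
by case/orP: zpos => /eqP ->; rewrite div0n; split; lia.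
Qed.

Section RatCodes.
Context (C : fun_class) (hC : good_class C).
Context (X : Type) (m : nat) (cX : X -> 'rV[nat]_m).

Lemma class_row_ratP (r : X -> rat) :
  class_row C cX (fun x => code_rat (r x)) <->
  [/\ class_nat C cX (fun x => rat_pos (r x)),
      class_nat C cX (fun x => rat_neg (r x)) &
      class_nat C cX (fun x => rat_den (r x))].
Proof.
split=> [Cr|[Cp Cn Cd]]; last first.
  exact: (class_row_mx (class_row_mx (class_row_nat Cp) (class_row_nat Cn))
    (class_row_nat Cd)).
split.
- apply: eq_class_nat (Cr (lshift 1 (lshift 1 (0 : 'I_1)))) => x.
  by rewrite /code_rat row_mxEl [LHS](@row_mxEl _ 1 1 1) mxE.
- apply: eq_class_nat (Cr (lshift 1 (rshift 1 (0 : 'I_1)))) => x.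
  by rewrite /code_rat row_mxEl [LHS](@row_mxEr _ 1 1 1) mxE.
- apply: eq_class_nat (Cr (rshift 2 (0 : 'I_1))) => x.
  by rewrite /code_rat row_mxEr mxE.
Qed.

Lemma class_row_ratvP (N : nat) (a : X -> 'rV[rat]_N) :
  class_row C cX (fun x => code_ratv (a x)) <->
  forall j, class_row C cX (fun x => code_rat (a x 0 j)).
Proof.
split=> [Ca j k|Ca k].
  by apply: eq_class_nat (Ca (mxvec_index j k)) => x; rewrite mxvecE mxE.
case/mxvec_indexP: k => j k.
by apply: eq_class_nat (Ca j k) => x; rewrite mxvecE mxE.
Qed.

Lemma class_nat_rat_dist_lt (r s : X -> rat) (q : X -> nat) :
  class_row C cX (fun x => code_rat (r x)) ->
  class_row C cX (fun x => code_rat (s x)) -> class_nat C cX q ->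
  class_nat C cX (fun x => `|r x - s x| * (q x)%:R < 2).
Proof.
move=> /class_row_ratP[rp rn rd] /class_row_ratP[sp sn sd] Cq.
have Ca := class_natD hC (class_natM hC rp sd) (class_natM hC sn rd).
have Cb := class_natD hC (class_natM hC rn sd) (class_natM hC sp rd).
have Cab := class_natD hC (class_natB hC Ca Cb) (class_natB hC Cb Ca).
have C2 := class_natM hC (class_nat_const hC cX 2) (class_natM hC rd sd).
have := class_nat_leq hC (class_natS hC (class_natM hC Cab Cq)) C2.
by apply: eq_class_nat => x; rewrite rat_dist_lt.
Qed.

Lemma class_row_rat_frac (i K k : X -> nat) : (forall x, 0 < k x)%N ->
  class_nat C cX i -> class_nat C cX K -> class_nat C cX k ->
  class_row C cX (fun x => code_rat (((i x)%:R - (K x)%:R) / (k x)%:R)).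
Proof.
move=> k0 Ci CK Ck.
have C1 := class_natB hC Ci CK; have C2 := class_natB hC CK Ci.
have Cg := class_nat_gcd hC k0 (class_natD hC C1 C2) Ck.
apply/class_row_ratP; split.
- apply: eq_class_nat (class_nat_div hC C1 Cg) => x.
  by have [-> _ _] := rat_frac (i x) (K x) (k0 x).
- apply: eq_class_nat (class_nat_div hC C2 Cg) => x.
  by have [_ -> _] := rat_frac (i x) (K x) (k0 x).
- apply: eq_class_nat (class_nat_div hC Ck Cg) => x.
  by have [_ _ ->] := rat_frac (i x) (K x) (k0 x).
Qed.

End RatCodes.

(** * Rational grids indexed by one number *)

Definition digit (B j i : nat) : nat := ((i %/ B ^ j) %% B)%N.

(** Horner's scheme: [t 0] becomes the lowest digit, and the induction hypothesis supplies the
    others, shifted by one place. *)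
Lemma digits_surj (B N : nat) (t : nat -> nat) : (forall j, t j < B)%N ->
  exists2 i, (i < B ^ N)%N & forall j, (j < N)%N -> digit B j i = t j.
Proof.
elim: N t => [|N IH] t tB; first by exists 0%N.
have [i iB it] := IH (t \o succn) (fun j => tB j.+1).
have B0 : (0 < B)%N by exact: leq_ltn_trans (tB 0%N).
exists (t 0 + i * B)%N.
  rewrite expnSr (leq_trans _ (_ : i.+1 * B <= _)%N) //.
    by rewrite mulSn ltn_add2r.
  by rewrite leq_mul2r iB orbT.
move=> [_|j jN]; first by rewrite /digit expn0 divn1 addnC modnMDl modn_small.
rewrite /digit expnS divnMA addnC divnMDl // (divn_small (tB 0%N)) addn0.
exact: it.
Qed.

(** The place [j] is fixed, so [B ^ j] has a fixed number of factors. *)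
Lemma class_nat_digit (C : fun_class) (hC : good_class C) (X : Type) (m : nat)
    (cX : X -> 'rV[nat]_m) (B i : X -> nat) (j : nat) :
  class_nat C cX B -> class_nat C cX i ->
  class_nat C cX (fun x => digit (B x) j (i x)).
Proof.
move=> CB Ci.
by apply: class_nat_mod => //; apply: class_nat_div => //; apply: class_natX.
Qed.

(** For [B = 2 * K + 1] the shifted digits run from [-K] to [K], so the indices below [B ^ N]
    enumerate the points of mesh [1 / k] in the cube of radius [K / k]. *)
Definition grid (N k K B i : nat) : 'rV[rat]_N :=
  \row_j (((digit B j i)%:R - K%:R) / k%:R).

Lemma class_row_grid (C : fun_class) (hC : good_class C) (X : Type) (m N : nat)
    (cX : X -> 'rV[nat]_m) (k K B i : X -> nat) : (forall x, 0 < k x)%N ->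
  class_nat C cX k -> class_nat C cX K -> class_nat C cX B ->
  class_nat C cX i ->
  class_row C cX (fun x => code_ratv (grid N (k x) (K x) (B x) (i x))).
Proof.
move=> k0 Ck CK CB Ci; apply/class_row_ratvP => j l.
have Cd := class_nat_digit hC j CB Ci.
by apply: eq_class_nat (class_row_rat_frac hC k0 Cd CK Ck l) => x; rewrite !mxE.
Qed.

(** * The sets [inner O e] and approximation by grid points *)

Section Reals.
Context (R : realType) (N : nat).
Implicit Types (O : set 'rV[R]_N) (x y : 'rV[R]_N) (e : nat).

Lemma row_norm_lt x (r : R) : 0 < r -> (`|x| < r) <-> forall j, `|x 0 j| < r.
Proof.
move=> r0; rewrite /Num.norm /= mx_normrE; split=> [|xr].
  by move/bigmax_ltP => [_ xr] j; apply: (xr (0, j)).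
by apply/bigmax_ltP; split => // -[i j] _ /=; rewrite ord1; exact: xr.
Qed.

Lemma row_coord_le x j : `|x 0 j| <= `|x|.
Proof.
rewrite [leRHS]/Num.norm /= mx_normrE.
by have /= -> // := @le_bigmax _ _ _ 0 (fun k => `|x k.1 k.2|) (0, j).
Qed.

(** Replaces the extended-real distance by plain inequalities; both sides hold when [A] is empty. *)
Lemma le_edist_infP (A : set 'rV[R]_N) x (r : R) :
  (r%:E <= edist_inf A x)%E <-> forall a, A a -> r <= `|x - a|.
Proof.
split=> [rA a Aa|rA].
  rewrite leNgt; apply/negP => xar.
  have : (edist_inf A x <= edist (x, a))%E by apply: ereal_inf_lbound; exists a.
  move=> /(le_trans rA); rewrite leNgt => /negP; apply.
  (* The midpoint lies strictly between the norm of [x - a] and [r]: a ball of this radius around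
     [x] contains [a], which forces the distance below [r]. *)
  pose r' := (`|x - a| + r) / 2.
  have x0 := normr_ge0 (x - a).
  apply: (@le_lt_trans _ _ r'%:E); last by rewrite lte_fin /r'; lra.
  apply: edist_fin; first by rewrite /r'; lra.
  by rewrite mx_norm_ball /ball_ /= /r'; lra.
apply: le_ereal_inf_tmp => _ [a Aa <-].
rewrite leNgt; apply/negP => /edist_lt_ball.
by rewrite mx_norm_ball /ball_ /= ltNge rA.
Qed.

Lemma inner_mono O e e' : (0 < e)%N -> (e <= e')%N -> inner O e `<=` inner O e'.
Proof.
move=> e0 ee' x [Ox xe /le_edist_infP dx].
split=> //; first by rewrite (le_trans xe) // ler_nat.
apply/le_edist_infP => a /dx; apply: le_trans.
by rewrite lef_pV2 ?posrE ?ltr0n ?ler_nat // (leq_trans e0).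
Qed.

(** The move costs at most half of the distance [1 / e] to the complement and raises the norm by at
    most [1 <= e]. *)
Lemma inner_near O e x y : (0 < e)%N -> inner O e x ->
  `|x - y| <= (2 * e)%:R^-1 -> inner O (2 * e) y.
Proof.
move=> e0 [Ox xe /le_edist_infP dx] xy.
have eR : 1 <= e%:R :> R by rewrite ler1n.
have eV : (2 * e)%:R^-1 * 2 = e%:R^-1 :> R by rewrite natrM; field; lra.
have ePos : 0 < (2 * e)%:R^-1 :> R by rewrite invr_gt0 ltr0n muln_gt0.
have eLe : (2 * e)%:R^-1 <= 1 :> R.
  by rewrite invf_le1 ?ltr0n ?muln_gt0 // ler1n muln_gt0.
split.
- by apply: contrapT => nOy; have := dx _ nOy; lra.
- have := ler_normB x (x - y); rewrite subKr natrM => ?; lra.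
- apply/le_edist_infP => a /dx; have := ler_distD y x a; lra.
Qed.

(** For the maximum norm, a bound on real vectors splits into finitely many rational tests, which
    the search can evaluate. *)
Lemma ratvB_dist_lt (a b : 'rV[rat]_N) (q : nat) : (0 < q)%N ->
  (`|ratv R a - ratv R b| < 2 / q%:R) <->
  all (fun j => `|a 0 j - b 0 j| * q%:R < 2) (enum 'I_N).
Proof.
move=> q0; have qR : 0 < q%:R :> R by rewrite ltr0n.
have jE j : (`|(ratv R a - ratv R b) 0 j| < 2 / q%:R) =
    (`|a 0 j - b 0 j| * q%:R < 2).
  rewrite !mxE -rmorphB -ratr_norm ltr_pdivlMr // -(ratr_nat R q) -rmorphM /=.
  by rewrite -(ratr_nat R 2) ltr_rat.
rewrite row_norm_lt ?divr_gt0 //; split=> [ab|/allP ab j].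
  by apply/allP => j _; rewrite -jE.
by rewrite jE ab // mem_enum.
Qed.

(** Each coordinate is rounded down to a multiple of [1 / k]. Adding [e * k] before taking the floor
    shifts the result into the range of a digit in base [2 * (e * k) + 1]. *)
Lemma ratv_grid (e k : nat) x : (0 < k)%N -> `|x| <= e%:R ->
  exists2 i, (i < (2 * (e * k)).+1 ^ N)%N &
    `|x - ratv R (grid N k (e * k) (2 * (e * k)).+1 i)| < k%:R^-1.
Proof.
move=> k0 xe; have kR : 0 < k%:R :> R by rewrite ltr0n.
pose t (j : 'I_N) := Num.floor (x 0 j * k%:R + (e * k)%:R).
have tb j : (0 <= t j)%R && (t j < (2 * (e * k)).+1%:Z)%R.
  have := le_trans (row_coord_le x j) xe; rewrite ler_norml => /andP[lo hi].
  rewrite floor_ge0 /t natrM -mulrDl; apply/andP; split.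
    by apply: mulr_ge0; [lra|exact: ltW].
  rewrite floor_lt_int -pmulrn -natr1 !natrM.
  have : (x 0 j + e%:R) * k%:R <= (2 * e%:R) * k%:R.
    by apply: ler_wpM2r; [exact: ltW|lra].
  by rewrite mulrA; lra.
(* [digits_surj] expects digits at all places; 0 fills those from [N] on. *)
pose s (j : nat) := if insub j is Some j' then absz (t j') else 0%N.
have sB j : (s j < (2 * (e * k)).+1)%N.
  rewrite /s; case: insubP => // j' _ _.
  by move: (t j') (tb j') => z /andP[]; lia.
have [i iB it] := digits_surj N sB; exists i => //.
apply/row_norm_lt; first by rewrite invr_gt0.
move=> j; rewrite !mxE it // /s valK.
have tE : (absz (t j))%:R = (t j)%:~R :> rat.
  by rewrite pmulrn gez0_abs //; case/andP: (tb j).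
rewrite tE fmorph_div /= rmorphB /= ratr_int !ratr_nat.
have := floor_itv (x 0 j * k%:R + (e * k)%:R).
rewrite -/(t j) intrD => /andP[lo hi].
have -> : x 0 j - ((t j)%:~R - (e * k)%:R) / k%:R =
    (x 0 j * k%:R + (e * k)%:R - (t j)%:~R) / k%:R by field; lra.
rewrite ger0_norm; last by apply: divr_ge0; [lra|exact: ltW].
by rewrite -[ltRHS]mul1r ltr_pM2r ?invr_gt0 //; lra.
Qed.

End Reals.

(** * Computing the inverse function *)

Lemma in_class1_code (C : fun_class) (d : nat -> nat) :
  class_nat C code_nat d -> in_class1 C d.
Proof.
move=> [phi [Cphi phid]]; rewrite /in_class1.
rewrite (_ : (fun x => _) = phi) //; apply/funext => x.
by rewrite -phid; congr phi; apply/rowP => k; rewrite mxE ord1.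
Qed.

Lemma class_row_fun (C : fun_class) (hC : good_class C) (X : Type) (m N M : nat)
    (cX : X -> 'rV[nat]_m) (f : 'rV[rat]_N * nat -> 'rV[rat]_M)
    (a : X -> 'rV[rat]_N) (e : X -> nat) :
  in_class_fun C (fun ae => row_mx (code_ratv ae.1) (code_nat ae.2))
    (@code_ratv M) f ->
  class_row C cX (fun x => code_ratv (a x)) -> class_nat C cX e ->
  class_row C cX (fun x => code_ratv (f (a x, e x))).
Proof.
move=> Cf Ca /class_row_nat Ce k; have [phi [Cphi phif]] := Cf k.
apply: eq_class_nat (class_nat_comp hC Cphi (class_row_mx Ca Ce)) => x.
by rewrite -phif.
Qed.

Theorem theorem7p3 (R : realType) (C : fun_class) (N : nat)
    (O V : set 'rV[R]_N) (F G : 'rV[R]_N -> 'rV[R]_N)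
    (hC : good_class C)
    (hO : class_approximable C O)
    (hV : open V)
    (hbij : set_bij O V F)
    (hF : in_class_real C O F)
    (hGV : set_fun V O G)
    (hGF : {in O, cancel F G})
    (hFG : {in V, cancel G F})
    (hi : exists d' : nat -> nat,
        in_class1 C d' /\
        forall e : nat, (0 < e)%N ->
          (0 < d' e)%N /\
          forall y y' : 'rV[R]_N, inner V e y -> inner V e y' ->
            `|y - y'| < (d' e)%:R^-1 -> `|G y - G y'| < e%:R^-1)
    (hii : class_compact C V O G) :
  in_class_real C V G.
Proof.
case: hO => _ [A [alpha [[chi [Cchi chiP]] Calpha AP]]].
case: hF => d [f [Cd Cf d0 fP]].
case: hi => d' [Cd' d'P]; case: hii => gam [Cgam gamP].
(* [gam] bounds [G y], [2 * gam e] selects the sets [A] that contain the grid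
   points near [G y], and [D] is the precision at which [F] is approximated: it
   dominates every index in sight, and [4 / D e] is at most [1 / (2 * e)] and
   [1 / d' (2 * e)]. *)
pose D e := (8 * e + 4 * d' (2 * e) + alpha (2 * gam e) + 2 * gam e)%N.
(* The mesh [1 / k e] is below [1 / d (D e)], so that [f] approximates [F (G y)] from a grid point
   next to [G y], and below [1 / (2 * gam e)], so that this point stays in [A]. The successor keeps
   [k] positive even at 0. *)
pose k e := (d (D e) + 2 * gam e).+1.
pose K e := (gam e * k e)%N.
pose B e := (2 * K e).+1.
pose a e i := grid N (k e) (K e) (B e) i.
(* The second test bounds the distance from [b] to [f] by [2 / D e]: one [1 / D e] for the distance
   from [b] to [y], one for the error of [f]. *)
pose P (be : 'rV[rat]_N * nat) i :=
  (chi (row_mx (code_nat (2 * gam be.2)) (code_ratv (a be.2 i))) == 1)%N &&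
  all (fun j => `|be.1 0 j - f (a be.2 i, D be.2) 0 j| * (D be.2)%:R < 2)
    (enum 'I_N).
pose w be := find (P be) (iota 0 (B be.2 ^ N).+1).
(* The parameters are treated for arbitrary coded arguments, as they are also needed under the
   search variable. *)
have CD X m (cX : X -> 'rV_m) (e : X -> nat) :
    class_nat C cX e -> class_nat C cX (fun x => D (e x)).
  move=> Ce; have Cc c := class_nat_const hC cX c.
  have Cg := class_natM hC (Cc 2) (class_nat_comp1 hC Cgam Ce).
  apply: (class_natD hC _ Cg).
  apply: (class_natD hC _ (class_nat_comp1 hC Calpha Cg)).
  apply: (class_natD hC (class_natM hC (Cc 8) Ce)).
  apply: (class_natM hC (Cc 4)).
  exact: (class_nat_comp1 hC Cd' (class_natM hC (Cc 2) Ce)).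
have Ck X m (cX : X -> 'rV_m) (e : X -> nat) :
    class_nat C cX e -> class_nat C cX (fun x => k (e x)).
  move=> Ce; apply: (class_natS hC).
  apply: (class_natD hC (class_nat_comp1 hC Cd (CD _ _ _ _ Ce))).
  exact: (class_natM hC (class_nat_const hC cX 2) (class_nat_comp1 hC Cgam Ce)).
have CK X m (cX : X -> 'rV_m) (e : X -> nat) :
    class_nat C cX e -> class_nat C cX (fun x => K (e x)).
  move=> Ce.
  exact: (class_natM hC (class_nat_comp1 hC Cgam Ce) (Ck _ _ _ _ Ce)).
have CB X m (cX : X -> 'rV_m) (e : X -> nat) :
    class_nat C cX e -> class_nat C cX (fun x => B (e x)).
  move=> Ce; apply: (class_natS hC).
  exact: (class_natM hC (class_nat_const hC cX 2) (CK _ _ _ _ Ce)).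
have Ca X m (cX : X -> 'rV_m) (e i : X -> nat) :
    class_nat C cX e -> class_nat C cX i ->
    class_row C cX (fun x => code_ratv (a (e x) (i x))).
  move=> Ce Ci; apply: class_row_grid => //; [exact: Ck|exact: CK|exact: CB].
pose cX (be : 'rV[rat]_N * nat) := row_mx (code_ratv be.1) (code_nat be.2).
have Cb : class_row C cX (fun be => code_ratv be.1).
  move=> l; apply: eq_class_nat (class_nat_proj hC cX (lshift 1 l)) => be.
  by rewrite row_mxEl.
have Ce : class_nat C cX (fun be => be.2).
  apply: eq_class_nat (class_nat_proj hC cX (rshift _ (0 : 'I_1))) => be.
  by rewrite row_mxEr mxE.
have Cw : class_nat C cX w.
  apply: (class_nat_find hC); last exact: (class_natX hC _ (CB _ _ _ _ Ce)).
  have Cew := class_nat_weak hC Ce.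
  have Caw := Ca _ _ _ _ _ Cew (class_nat_var hC cX).
  apply: (class_nat_and hC).
    apply: (class_nat_eq hC _ (class_nat_const hC _ 1)).
    apply: (class_nat_comp hC Cchi); apply: class_row_mx Caw.
    apply: class_row_nat.
    apply: (class_natM hC (class_nat_const hC _ 2)).
    exact: (class_nat_comp1 hC Cgam Cew).
  apply: (class_nat_all hC) => j.
  apply: (class_nat_rat_dist_lt hC); last exact: CD Cew.
    move/class_row_ratvP : Cb => /(_ j) Cbj l.
    exact: (class_nat_weak hC (Cbj l)).
  by have /class_row_ratvP/(_ j) := class_row_fun hC Cf Caw (CD _ _ _ _ Cew).
exists D, (fun be => a be.2 (w be)); split.
- apply: in_class1_code; apply: CD.
  by apply: eq_class_nat (class_nat_proj hC code_nat 0) => e; rewrite mxE.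
- exact: (Ca _ _ _ _ _ Ce Cw).
- by move=> e e0; rewrite /D; lia.
move=> e b y e0 Vy yb.
have [g0 gV] := gamP e e0.
have gg0 : (0 < 2 * gam e)%N by rewrite muln_gt0.
have [al0 OA AO] := AP _ gg0.
have ee0 : (0 < 2 * e)%N by rewrite muln_gt0.
have [d'0 d'G] := d'P _ ee0.
have D0 : (0 < D e)%N by rewrite /D; lia.
have DR : 0 < (D e)%:R^-1 :> R by rewrite invr_gt0 ltr0n.
have OGy : inner O (gam e) (G y) by apply: gV; exists y.
have VyV : V y by case: Vy.
have FGy : F (G y) = y by rewrite hFG // inE.
have chiE i : (chi (row_mx (code_nat (2 * gam e)) (code_ratv (a e i))) == 1)%N =
    `[< A (2 * gam e)%N (a e i) >].
  by rewrite (chiP ((2 * gam e)%N, a e i) gg0) eqb1.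
(* The search succeeds: a grid point next to [G y] passes both tests. *)
have [i iB ai] : exists2 i, (i < (B e ^ N).+1)%N & P (b, e) i.
  have k0 : (0 < k e)%N by [].
  have Gg : `|G y| <= (gam e)%:R by case: OGy.
  have [i iB ai] := ratv_grid k0 Gg; exists i; first exact: ltnW.
  rewrite -/(K e) -/(B e) -/(a e i) in ai.
  have leV c : (0 < c)%N -> (c <= k e)%N -> (k e)%:R^-1 <= c%:R^-1 :> R.
    by move=> c0 ck; rewrite lef_pV2 ?posrE ?ltr0n ?ler_nat.
  apply/andP; split => /=.
    rewrite chiE; apply/asboolP; apply: OA => /=.
    apply: inner_near OGy _ => //.
    by apply: (le_trans (ltW ai)); apply: leV => //; rewrite /k; lia.
  apply/(ratvB_dist_lt R) => //.
  have OD : inner O (D e) (G y).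
    by apply: (inner_mono g0 _ OGy); rewrite /D; lia.
  have := fP _ (a e i) _ D0 OD; rewrite FGy => /(_ _)/wrap[].
    apply: (lt_le_trans ai); apply: leV; first exact: d0.
    by rewrite /k; lia.
  have := ler_distD y (ratv R b) (ratv R (f (a e i, D e))).
  rewrite (distrC _ y); lra.
have hP : has (P (b, e)) (iota 0 (B e ^ N).+1).
  by apply/hasP; exists i => //; rewrite mem_iota.
have := nth_find 0%N hP; rewrite nth_iota ?add0n; last first.
  by move: hP; rewrite has_find size_iota.
rewrite -/(w (b, e)) /=; set aw := a e _ => /andP[/=].
rewrite chiE => /asboolP Aaw /(ratvB_dist_lt R) -/(_ D0) baw.
(* Membership in [A] places the point found in an inner set of [O] whose index is at most [D e], so
   [f] approximates [F] at this very point. *)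
have OAaw : inner O (alpha (2 * gam e)) (ratv R aw) by apply: AO; exists aw.
have ODaw : inner O (D e) (ratv R aw).
  by apply: (inner_mono al0 _ OAaw); rewrite /D; lia.
have Faw : `|F (ratv R aw) - ratv R (f (aw, D e))| < (D e)%:R^-1.
  by apply: fP => //; rewrite subrr normr0 invr_gt0 ltr0n d0.
(* The errors are [1 / D e] from [y] to [b], [2 / D e] from [b] to [f] and [1 / D e] from [f] to
   [F]. *)
have yF : `|y - F (ratv R aw)| < 4 * (D e)%:R^-1.
  have := ler_distD (ratv R b) y (F (ratv R aw)).
  have := ler_distD (ratv R (f (aw, D e))) (ratv R b) (F (ratv R aw)).
  by move: Faw baw; rewrite -/aw (distrC (F _) (ratv R (f _))); lra.
have leD c : (0 < c)%N -> (4 * c <= D e)%N -> 4 * (D e)%:R^-1 <= c%:R^-1 :> R.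
  move=> c0 cD; rewrite ler_pdivrMr ?ltr0n // ler_pdivlMl ?ltr0n //.
  by rewrite -natrM ler_nat mulnC.
(* The modulus of [G] is used at [2 * e], since [F (ratv R aw)] is only known to lie in the inner
   set of that index. *)
have Vy2 : inner V (2 * e) y by apply: (inner_mono e0 _ Vy); lia.
have VF : inner V (2 * e) (F (ratv R aw)).
  apply: (inner_near e0 Vy); apply: (le_trans (ltW yF)).
  by apply: leD => //; rewrite /D; lia.
have := d'G _ _ Vy2 VF; rewrite hGF ?inE; last by case: ODaw.
have -> : `|y - F (ratv R aw)| < (d' (2 * e))%:R^-1.
  apply: (lt_le_trans yF); apply: leD => //.
  by rewrite /D; move: (d' _) => u; lia.
move=> /(_ isT) /lt_le_trans; apply.
by rewrite lef_pV2 ?posrE ?ltr0n // ler_nat; lia.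
Qed.
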